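(* Let $\lambda\in\mathbb R$. If (i) $r\neq0$, (ii) $r+s=0$, and (iii) $2\lambda=r-d$, then $L,(L^*+\lambda)^2$ is a Leonard pair on $\mathcal P_d(\mathbb R)$. Conversely, if $d\ge3$ and $L,(L^*+\lambda)^2$ is a Leonard pair, then (i), (ii) and (iii) hold.
   Context: Fix an integer $d\ge0$ and $r,s\in(-1,\infty)$. Write $(x)_i=x(x+1)\cdots(x+i-1)$, $(x)_0=1$. For $0\le i\le d$ put $\theta_i=(d-i)(d-i+r+s+1)$ (distinct) and $\theta^*_i=i$. Put $b^*_i=\frac{(d-i)(i-d-s)(2d-2i+r+s+2)_i}{(2d-2i+r+s)_{i+1}}$ ($0\le i\le d-1$), $c^*_i=\frac{i(i-d-r-1)(d-i+r+s+1)_{d-i}}{(d-i+r+s+2)_{d-i+1}}$ ($1\le i\le d$), $b^*_d=c^*_0=0$, and $a^*_i=\theta^*_0-b^*_i-c^*_i$. Let $\mathcal P_d(\mathbb R)$ be the real polynomials of degree at most $d$, each determined by its values at $\theta_0,\dots,\theta_d$. Let $L,L^*$ be the linear maps on $\mathcal P_d(\mathbb R)$ with $(Lf)(\theta_i)=\theta_i f(\theta_i)$ and $(L^*f)(\theta_i)=b^*_i f(\theta_{i+1})+a^*_i f(\theta_i)+c^*_i f(\theta_{i-1})$ ($0\le i\le d$; terms with coefficient $b^*_d$ or $c^*_0$ omitted); $\lambda$ stands for $\lambda$ times the identity. A square matrix is irreducible tridiagonal if its nonzero entries lie on the diagonal, subdiagonal or superdiagonal and all subdiagonal and superdiagonal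 entries are nonzero. A Leonard pair on a nonzero finite-dimensional vector space $V$ is an ordered pair $A,A^*$ of linear maps on $V$ such that there is an ordered basis in which $A$ is diagonal and $A^*$ is irreducible tridiagonal, and there is an ordered basis in which $A^*$ is diagonal and $A$ is irreducible tridiagonal. *)

(* Defs.v *)
From HB Require Import structures.
From mathcomp Require Import all_boot all_order all_algebra.
From mathcomp Require Import reals.
Set Implicit Arguments. Unset Strict Implicit. Unset Printing Implicit Defensive.
Import Order.TTheory GRing.Theory Num.Theory.
Local Open Scope ring_scope.

Section Defs.
Variable R : realType.

Definition poch (x : R) (i : nat) : R := \prod_(k < i) (x + k%:R).

Definition theta (d : nat) (r s : R) (i : nat) : R :=
  (d - i)%:R * ((d - i)%:R + r + s + 1).

Definition thetas (i : nat) : R := i%:R.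

Definition bs (d : nat) (r s : R) (i : nat) : R :=
  if (i < d)%N then
    (d - i)%:R * (i%:R - d%:R - s) * poch (2 * (d - i)%:R + r + s + 2) i
      / poch (2 * (d - i)%:R + r + s) i.+1
  else 0.

Definition cs (d : nat) (r s : R) (i : nat) : R :=
  if (0 < i)%N then
    i%:R * (i%:R - d%:R - r - 1) * poch ((d - i)%:R + r + s + 1) (d - i)
      / poch ((d - i)%:R + r + s + 2) (d - i).+1
  else 0.

Definition as_ (d : nat) (r s : R) (i : nat) : R :=
  thetas 0 - bs d r s i - cs d r s i.

(* P_d(R) is identified with R^(d+1) via f |-> (f(theta_0), ..., f(theta_d))
   (column vectors); L and L* are given by their matrices in this coordinate
   system (the basis of Lagrange interpolation polynomials at the theta_i). *)
Definition Lmx (d : nat) (r s : R) : 'M[R]_(d.+1) :=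
  \matrix_(i, j) if i == j then theta d r s i else 0.

Definition Lsmx (d : nat) (r s : R) : 'M[R]_(d.+1) :=
  \matrix_(i, j)
    if (j : nat) == i.+1 then bs d r s i
    else if (j : nat) == i then as_ d r s i
    else if (j.+1 == i)%N then cs d r s i
    else 0.

Definition is_diagonal n (M : 'M[R]_n) : Prop :=
  forall i j : 'I_n, i != j -> M i j = 0.

Definition irred_tridiagonal n (M : 'M[R]_n) : Prop :=
  (forall i j : 'I_n, (i.+1 < j)%N \/ (j.+1 < i)%N -> M i j = 0) /\
  (forall i j : 'I_n, (j : nat) = i.+1 -> M i j != 0 /\ M j i != 0).

(* Leonard pair on R^n (n > 0): an ordered basis is given by the columns of an
   invertible matrix P; the matrix of A in that basis is P^-1 A P. *)
Definition leonard_pair n (A As : 'M[R]_n) : Prop :=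
  (0 < n)%N /\
  (exists P : 'M[R]_n, P \in unitmx /\
     is_diagonal (invmx P *m A *m P) /\ irred_tridiagonal (invmx P *m As *m P)) /\
  (exists Q : 'M[R]_n, Q \in unitmx /\
     is_diagonal (invmx Q *m As *m Q) /\ irred_tridiagonal (invmx Q *m A *m Q)).

End Defs.

(* Main.v *)
Require Import Defs.
From HB Require Import structures.
From mathcomp Require Import all_boot all_order all_fingroup all_algebra.
From mathcomp Require Import reals.
From mathcomp Require Import zify ring lra.
Import Order.TTheory GRing.Theory Num.Theory.
Local Open Scope ring_scope.

(* With k = d - i and u = r + s, the diagonal entry a*_i equals A + w g(k), where
   A = (2d - r + s)/4, w = (r - s)(2d + u + 2)/4, g(k) = u/((2k + u)(2k + u + 2))
   for k > 0 and g(0) = 1/(u + 2).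

   Any basis diagonalizing L is, up to order and scaling, the standard one, as the
   theta_i are distinct.  Hence (L* + lam)^2 is irreducible tridiagonal in such a
   basis iff the graph of its nonzero off-diagonal entries is a path.  That graph
   joins k to k+2 always, and k to k+1 iff
   t_k = a*_(d-k) + a*_(d-k-1) + 2 lam is nonzero.  For d >= 3 a path has exactly
   one edge of the second kind, at k = 0, at k = d - 1, or (when d = 3) at k = 1.
   In the last two cases the vanishing of the other t_k forces w = 0, hence all t_k
   equal, a contradiction; in the first case it forces u = 0 and then lam.

   Conversely, when u = 0 all t_k with k > 0 vanish for the given lam, the graph is
   the path ... 3, 1, 0, 2, 4 ..., and L* has a basis of dual Hahn polynomials, in
   which multiplication by theta is given by the three-term recurrence. *)

(** * Quotients of Pochhammer symbols *)

Section Pochhammer.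
Variable R : realType.
Implicit Types (x : R) (n k : nat).

Lemma poch0 x : poch x 0 = 1.
Proof. by rewrite /poch big_ord0. Qed.

Lemma pochSr x n : poch x n.+1 = poch x n * (x + n%:R).
Proof. by rewrite /poch big_ord_recr. Qed.

Lemma pochS x n : poch x n.+1 = x * poch (x + 1) n.
Proof.
rewrite /poch big_ord_recl /= addr0; congr (_ * _).
by apply: eq_bigr => k _; rewrite /bump /= add1n -addn1 natrD; ring.
Qed.

Lemma poch_gt0 x n : 0 < x -> 0 < poch x n.
Proof. by move=> x0; apply: prodr_gt0 => k _; rewrite ltr_wpDr. Qed.

(** Both cross products are [poch x n.+2], with factors split off at different ends. *)
Lemma poch_ratio2 x n : 0 < x ->
  poch (x + 2) n / poch x n.+1 = (x + n%:R + 1) / (x * (x + 1)).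
Proof.
move=> x0; have p0 := @poch_gt0 x n.+1 x0.
have q0 : poch x n.+1 != 0 by rewrite gt_eqF.
have x10 : x * (x + 1) != 0 by rewrite gt_eqF// mulr_gt0 // ltr_wpDr.
apply/eqP; rewrite eqr_div //; apply/eqP.
rewrite [RHS]mulrC.
have -> : poch x n.+1 * (x + n%:R + 1) = poch x n.+2.
  by rewrite (pochSr x n.+1) -natr1 addrA.
have -> : poch x n.+2 = x * ((x + 1) * poch (x + 2) n).
  by rewrite 2!pochS -addrA.
by ring.
Qed.

Lemma poch_ratio1 x n : 0 < x ->
  poch x n / poch (x + 1) n.+1 = x / ((x + n%:R) * (x + n%:R + 1)).
Proof.
move=> x0; have p0 : poch (x + 1) n.+1 != 0.
  by rewrite gt_eqF// poch_gt0 // ltr_wpDr.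
have n0 : 0 <= n%:R :> R by [].
have xn0 : (x + n%:R) * (x + n%:R + 1) != 0.
  by rewrite gt_eqF// mulr_gt0 //; lra.
apply/eqP; rewrite eqr_div //; apply/eqP.
by rewrite -(pochS x n.+1) 2!pochSr -natr1; ring.
Qed.

End Pochhammer.

(** * Closed forms of the entries of L*, with k = d - i *)

Section Entries.
Variables (R : realType) (d : nat) (r s : R).
Implicit Types k : nat.
Local Notation u := (r + s).

Let k1 k : (0 < k)%N -> 1 <= k%:R :> R.
Proof. by move=> ?; rewrite ler1n. Qed.

Lemma bs_rev (hr : -1 < r) (hs : -1 < s) k : (0 < k <= d)%N ->
  bs d r s (d - k) = - (k%:R * (k%:R + s) * (k%:R + d%:R + u + 1))
                     / ((2 * k%:R + u) * (2 * k%:R + u + 1)).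
Proof.
move=> /andP[k0 kd]; rewrite /bs ifT; last by lia.
rewrite subKn // natrB // -mulrA.
have -> : 2 * k%:R + r + s = 2 * k%:R + u by ring.
rewrite poch_ratio2; last by have := k1 k k0; lra.
by rewrite natrB //; ring.
Qed.

Lemma bs_rev0 : bs d r s d = 0.
Proof. by rewrite /bs ltnn. Qed.

Lemma cs0 : cs d r s 0 = 0. Proof. by []. Qed.

(** For k > 0 the base k + u + 1 is positive. At k = 0 it is u + 1, which can vanish, hence the
    separate [cs_rev0]. *)
Lemma cs_rev (hr : -1 < r) (hs : -1 < s) k : (0 < k <= d)%N ->
  cs d r s (d - k) = - ((d%:R - k%:R) * (k%:R + r + 1) * (k%:R + u + 1))
                     / ((2 * k%:R + u + 1) * (2 * k%:R + u + 2)).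
Proof.
move=> /andP[k0]; rewrite leq_eqVlt => /predU1P[->|kd].
  by rewrite subnn cs0 subrr !mul0r oppr0 mul0r.
rewrite /cs ifT; last by lia.
rewrite subKn ?(ltnW kd)// natrB ?(ltnW kd)// -mulrA.
have -> : k%:R + r + s + 1 = k%:R + u + 1 by ring.
have -> : k%:R + r + s + 2 = k%:R + u + 1 + 1 by ring.
rewrite poch_ratio1; last by have := k1 k k0; lra.
have -> : 2 * k%:R + u + 1 = k%:R + u + 1 + k%:R by ring.
have -> : 2 * k%:R + u + 2 = k%:R + u + 1 + k%:R + 1 by ring.
by ring.
Qed.

Lemma cs_rev0 (hr : -1 < r) (hs : -1 < s) :
  cs d r s d = - (d%:R * (r + 1)) / (u + 2).
Proof.
rewrite /cs; case: d => [|d']; first by rewrite !mul0r oppr0 mul0r.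
rewrite ltn0Sn subnn poch0 pochSr poch0 !add0r addr0 mul1r.
by rewrite mulr1; congr (_ / _); ring.
Qed.

Lemma bs_neq0 (hr : -1 < r) (hs : -1 < s) i : (i < d)%N -> bs d r s i != 0.
Proof.
move=> id; have -> : i = (d - (d - i))%N by lia.
rewrite bs_rev //; last by lia.
have := k1 (d - i); rewrite subn_gt0 => /(_ id) h.
have d0 : 0 <= d%:R :> R by [].
rewrite !(mulf_eq0, oppr_eq0, invr_eq0) !negb_or.
by do ?[apply/andP; split]; rewrite gt_eqF //; lra.
Qed.

Lemma cs_neq0 (hr : -1 < r) (hs : -1 < s) i : (0 < i <= d)%N -> cs d r s i != 0.
Proof.
move=> /andP[i0 id]; have [->|nid] := eqVneq i d.
  have hd : 0 < d%:R :> R by rewrite ltr0n; lia.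
  rewrite cs_rev0 // !(mulf_eq0, oppr_eq0, invr_eq0) !negb_or.
  by do ?[apply/andP; split]; rewrite gt_eqF //; lra.
have -> : i = (d - (d - i))%N by lia.
have h := k1 (d - i); have h2 := k1 i i0.
have h3 : 1 <= (d - i)%:R :> R by apply: h; lia.
rewrite cs_rev //; last by lia.
have h4 : (d - i)%:R < d%:R :> R by rewrite ltr_nat; lia.
rewrite !(mulf_eq0, oppr_eq0, invr_eq0) !negb_or.
by do ?[apply/andP; split]; rewrite gt_eqF //; lra.
Qed.

(** The factor 2k + u + 1 in the denominators of b* and c* cancels in their sum, and k survives in a
    single term. *)
Lemma as_rev (hr : -1 < r) (hs : -1 < s) k : (0 < k <= d)%N ->
  as_ d r s (d - k) = (2 * d%:R - r + s) / 4
    + (r - s) * (2 * d%:R + u + 2) / 4 * (u / ((2 * k%:R + u) * (2 * k%:R + u + 2))).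
Proof.
move=> /andP[k0 kd]; rewrite /as_ /thetas bs_rev ?k0//.
have h := k1 k k0.
rewrite cs_rev ?k0 //.
field.
by rewrite !gt_eqF//; lra.
Qed.

Lemma as_rev0 (hr : -1 < r) (hs : -1 < s) :
  as_ d r s d = (2 * d%:R - r + s) / 4
    + (r - s) * (2 * d%:R + u + 2) / 4 / (u + 2).
Proof.
rewrite /as_ /thetas bs_rev0 cs_rev0 //; field.
by rewrite !gt_eqF//; lra.
Qed.

End Entries.

(** * Sums along rows and columns of a tridiagonal matrix *)

Section Tridiagonal.
Variable R : realType.
Implicit Types b a c F : nat -> R.

Definition tri b a c (i j : nat) : R :=
  if j == i.+1 then b i else if j == i then a i
  else if j.+1 == i then c i else 0.

Lemma sum_pick n (m : nat) F :
  \sum_(k < n) (if k == m :> nat then F k else 0) = if (m < n)%N then F m else 0.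
Proof.
case: ltnP => mn.
  rewrite (bigD1 (Ordinal mn)) //= eqxx big1 ?addr0// => k.
  by rewrite -val_eqE /= => /negPf->.
by rewrite big1// => k _; case: eqP => // km; have := ltn_ord k; lia.
Qed.

Lemma triE b a c i j : tri b a c i j =
  (if j == i.+1 then b i else 0) + (if j == i then a i else 0)
  + (if (j == i.-1) && (0 < i)%N then c i else 0).
Proof.
by rewrite /tri; do !case: ifP => //; rewrite ?addr0 ?add0r //; lia.
Qed.

(** The zeros of [b] and [c] suppress the value outside the range at i = n and, at i = 0, the
    spurious [F 0] produced by the truncated predecessor. *)
Lemma sum_trir n b a c F i : b n = 0 -> c 0%N = 0 -> (i <= n)%N ->
  \sum_(k < n.+1) tri b a c i k * F k
    = b i * F i.+1 + a i * F i + c i * F i.-1.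
Proof.
move=> bn c0 le_in.
under eq_bigr => k _.
  rewrite triE.
  have -> : ((if k == i.+1 :> nat then b i else 0)
     + (if k == i :> nat then a i else 0)
     + (if (k == i.-1 :> nat) && (0 < i)%N then c i else 0)) * F k
   = (if k == i.+1 :> nat then b i * F k else 0)
     + (if k == i :> nat then a i * F k else 0)
     + (if (k == i.-1 :> nat) then c i * F k else 0).
    case: (posnP i) => [->|_]; rewrite ?c0 ?andbF ?andbT !mulrDl; congr (_ + _ + _);
    by case: ifP; rewrite ?mul0r.
  over.
rewrite !big_split /=.
rewrite (sum_pick n.+1 i.+1 (fun k => b i * F k)).
rewrite (sum_pick n.+1 i (fun k => a i * F k)).
rewrite (sum_pick n.+1 i.-1 (fun k => c i * F k)).
rewrite !ltnS le_in (leq_trans (leq_pred i) le_in).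
case: ltnP => // ni.
have {le_in ni} -> : i = n by apply/eqP; rewrite eqn_leq le_in.
by rewrite bn mul0r.
Qed.

Lemma tri_tr b a c i j :
  tri b a c i j = tri (fun k => c k.+1) a (fun k => b k.-1) j i.
Proof.
rewrite /tri; case: (ltngtP i j) => [ij|ij|->].
- by case: eqP => [->|?]; [rewrite eqxx /= ltn_eqF | do !case: eqP => //; lia].
- case: (i =P j.+1) => [->|?]; last by do !case: eqP => //; lia.
  by rewrite !eqxx; do !case: eqP => //; lia.
- by do !case: eqP => //; lia.
Qed.

(** This is the row sum of the transposed matrix. The alternative covers both ways in which the term
    of index n + 1 dies below: a zero coefficient, or a polynomial vanishing at all nodes. *)
Lemma sum_tril n b a c F j : c n.+1 = 0 \/ F n.+1 = 0 -> (j <= n)%N ->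
  \sum_(k < n.+1) F k * tri b a c k j
    = (if (0 < j)%N then F j.-1 * b j.-1 else 0) + F j * a j + F j.+1 * c j.+1.
Proof.
move=> Fn jn.
(* Cutting off at both ends supplies the boundary zeros that [sum_trir] demands. *)
pose b' k := if (k < n)%N then c k.+1 else 0.
pose c' k := if (0 < k)%N then b k.-1 else 0.
transitivity (\sum_(k < n.+1) tri b' a c' j k * F k).
  apply: eq_bigr => k _; rewrite mulrC tri_tr; congr (_ * _).
  rewrite /tri /b' /c'; have := ltn_ord k.
  by do !case: ifP => //; lia.
rewrite sum_trir //; last by rewrite /b' ltnn.
rewrite /b' /c'; case: (ltnP j n) => nj; first by case: ifP => _; ring.
have -> : F j.+1 * c j.+1 = 0.
  have -> : j = n by apply/eqP; rewrite eqn_leq jn.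
  by case: Fn => ->; rewrite ?mulr0 ?mul0r.
by case: ifP => _; ring.
Qed.

End Tridiagonal.

(** * Off-diagonal entries of the square *)

Section Square.
Variable R : realType.
Implicit Types b a c : nat -> R.

Definition trisq b a c (i j : nat) : R :=
  b i * tri R b a c i.+1 j + a i * tri R b a c i j + c i * tri R b a c i.-1 j.

Lemma tri_far b a c i j : (i.+1 < j)%N || (j.+1 < i)%N -> tri R b a c i j = 0.
Proof. by move=> ij; rewrite /tri !ifN_eq //; lia. Qed.

Lemma tri_up b a c i : tri R b a c i i.+1 = b i.
Proof. by rewrite /tri eqxx. Qed.

Lemma tri_diag b a c i : tri R b a c i i = a i.
Proof. by rewrite /tri ltn_eqF // eqxx. Qed.

Lemma tri_down b a c i : tri R b a c i.+1 i = c i.+1.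
Proof. by rewrite /tri; do !case: ifP => //; lia. Qed.

(** Above the diagonal the entry at distance one is b_x (a_x + a_(x+1)) and the entry at distance
    two is b_x b_(x+1). Below it they are c_(x+1) (a_x + a_(x+1)) and c_(x+2) c_(x+1). *)
Lemma trisq_neq0 n b a c x y : c 0%N = 0 ->
    (forall i, (i < n)%N -> b i != 0) -> (forall i, (0 < i <= n)%N -> c i != 0) ->
    (x < y <= n)%N ->
  (trisq b a c x y != 0) = (y == x.+2) || (y == x.+1) && (a x + a x.+1 != 0) /\
  (trisq b a c y x != 0) = (y == x.+2) || (y == x.+1) && (a x + a x.+1 != 0).
Proof.
move=> c0 bn0 cn0 /andP[xy yn]; rewrite /trisq.
case: (y =P x.+1) => [yx|/eqP nyx].
  rewrite yx eqn_leq ltnn andbF /= tri_up !tri_diag tri_down.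
  rewrite (tri_far _ _ _ x.+2) ?leqnn ?orbT //=.
  have -> : c x * tri R b a c x.-1 x.+1 = 0.
    by case: (posnP x) => [->|x0]; rewrite ?c0 ?mul0r // tri_far ?mulr0 //; lia.
  have -> : b x * a x.+1 + a x * b x + 0 = b x * (a x + a x.+1) by ring.
  have -> : b x.+1 * 0 + a x.+1 * c x.+1 + c x.+1 * a x = c x.+1 * (a x + a x.+1).
    by ring.
  by rewrite !mulf_eq0 !negb_or bn0 ?cn0 //; lia.
case: (y =P x.+2) => [yx|/eqP nyx2] /=.
  rewrite yx tri_up tri_down.
  rewrite (tri_far _ _ _ x) ?(tri_far _ _ _ x.-1) ?(tri_far _ _ _ x.+3);
    rewrite ?(tri_far _ _ _ x.+2) ?mulr0 ?addr0 ?add0r ?mulf_neq0 ?bn0 ?cn0 //; lia.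
by rewrite !tri_far ?mulr0 ?addr0 ?eqxx //; lia.
Qed.

End Square.

Lemma Lsmx_shiftE (R : realType) (d : nat) (r s lam : R) (i j : 'I_d.+1) :
  (Lsmx d r s + lam%:M) i j
    = tri R (bs d r s) (fun k => as_ d r s k + lam) (cs d r s) i j.
Proof.
rewrite !mxE /tri; have [->|ij] := eqVneq i j; first by rewrite ltn_eqF // eqxx.
by rewrite mulr0n addr0 [j == i :> nat]eq_sym val_eqE (negPf ij).
Qed.

Lemma Lsmx_sqE (R : realType) (d : nat) (r s lam : R) (i j : 'I_d.+1) :
  ((Lsmx d r s + lam%:M) *m (Lsmx d r s + lam%:M)) i j
    = trisq R (bs d r s) (fun k => as_ d r s k + lam) (cs d r s) i j.
Proof.
rewrite mxE; under eq_bigr do rewrite !Lsmx_shiftE.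
set b := bs d r s; set a := fun k : nat => _ + lam; set c := cs d r s.
by rewrite (sum_trir R d b a c (tri R b a c ^~ j)) ?/b ?bs_rev0 // -ltnS.
Qed.

Lemma Lsmx_sq_neq0 (R : realType) (d : nat) (r s lam : R) (i j : 'I_d.+1) :
    -1 < r -> -1 < s -> (i < j)%N ->
  let M := (Lsmx d r s + lam%:M) *m (Lsmx d r s + lam%:M) in
  let e := (j == i.+2 :> nat)
    || (j == i.+1 :> nat) && (as_ d r s i + as_ d r s i.+1 + 2 * lam != 0) in
  (M i j != 0) = e /\ (M j i != 0) = e.
Proof.
move=> hr hs ij M e.
rewrite /M !Lsmx_sqE /e.
have -> : as_ d r s i + as_ d r s i.+1 + 2 * lam
  = (as_ d r s i + lam) + (as_ d r s i.+1 + lam) by ring.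
apply: (trisq_neq0 R d) => //.
- by move=> k kd; rewrite bs_neq0.
- by move=> k kd; rewrite cs_neq0.
- by rewrite ij -ltnS /=.
Qed.

(** * Graphs embedded in a path *)

Section Path.

Definition adj (p q : nat) := (p == q.+1) || (q == p.+1).

Lemma adj_sym p q : adj p q = adj q p.
Proof. by rewrite /adj orbC. Qed.

(** Here [f] gives positions; by induction on the position, every element shares its value with the
    one in position 0. Used with parity as [g]. *)
Lemma path_const n (T : Type) (f : 'I_n.+1 -> 'I_n.+1) (g : 'I_n.+1 -> T) :
    injective f -> (forall x y, f y = (f x).+1 :> nat -> g x = g y) ->
  forall x y, g x = g y.
Proof.
move=> f_inj fg.
suff h p : forall x, f x = p :> nat -> g x = g (invF f_inj ord0).
  by move=> x y; rewrite (h (f x)) // (h (f y)).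
elim: p => [x fx|p IHp x fx].
  by rewrite -[x in LHS](invF_f f_inj); congr (g (invF _ _)); apply: val_inj.
have pn : (p < n.+1)%N by rewrite ltnW // -fx.
have fp : f (invF f_inj (Ordinal pn)) = p :> nat by rewrite f_invF.
by rewrite -(IHp _ fp); apply/esym/fg; rewrite fp fx.
Qed.

(** This and [adj_square] are the obstructions used below: a vertex of degree three and a
    4-cycle. *)
Lemma adj_three x p q m :
  adj x p -> adj x q -> adj x m -> p <> q -> p <> m -> q <> m -> False.
Proof. by move=> /orP[]/eqP-> /orP[]/eqP + /orP[]/eqP; lia. Qed.

Lemma adj_square p q m l :
  adj p q -> adj q m -> adj m l -> adj l p -> p <> m -> q <> l -> False.
Proof.
by move=> /orP[]/eqP-> /orP[]/eqP + /orP[]/eqP + /orP[]/eqP; lia.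
Qed.

(** Two chords among [e 0], [e 1], [e 2] give vertex 1 or 2 a third neighbour, except that for d = 3
    the chords [e 0] and [e 2] close the cycle 0, 1, 3, 2. For d > 3, [e 1] alone gives vertex 2 the
    neighbours 0, 1, 4. *)
Lemma path_chords d (rho : nat -> nat) (e : nat -> bool) :
    (3 <= d)%N ->
    (forall x y, (x <= d)%N -> (y <= d)%N -> rho x = rho y -> x = y) ->
    (forall k, (k.+1 < d)%N -> adj (rho k) (rho k.+2)) ->
    (forall k, (k < d)%N -> e k -> adj (rho k) (rho k.+1)) ->
  (e 0%N -> ~~ e 1%N /\ ~~ e 2%N) /\
  (e 1%N -> [/\ d = 3%N, ~~ e 0%N & ~~ e 2%N]).
Proof.
move=> d3 inj a2 a1.
have ne x y : (x < y <= d)%N -> rho x <> rho y.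
  by move=> /andP[xy yd] /inj; lia.
have a20 : adj (rho 2%N) (rho 0%N) by rewrite adj_sym a2 //; lia.
have a13 : adj (rho 1%N) (rho 3%N) by rewrite a2 //; lia.
have a10 : e 0%N -> adj (rho 1%N) (rho 0%N) by move=> e0; rewrite adj_sym a1 //; lia.
have a12 : e 1%N -> adj (rho 1%N) (rho 2%N) by move=> e1; rewrite a1 //; lia.
have a23 : e 2%N -> adj (rho 2%N) (rho 3%N) by move=> e2; rewrite a1 //; lia.
have ne01 : ~~ (e 0%N && e 1%N).
  apply/negP => /andP[/a10 e0 /a12 e1].
  by apply: (adj_three _ _ _ _ e0 e1 a13); apply: ne; lia.
have ne12 : ~~ (e 1%N && e 2%N).
  apply/negP => /andP[/a12 + /a23 e2]; rewrite adj_sym => e1.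
  by apply: (adj_three _ _ _ _ a20 e1 e2); apply: ne; lia.
have a24 : d != 3%N -> adj (rho 2%N) (rho 4%N) by move=> ?; rewrite a2 //; lia.
split=> [e0|e1].
  split; first by apply: contraNN ne01 => ->; rewrite e0.
  apply/negP => e2; have [_|d4] := eqVneq d 3%N.
    by apply: (adj_square _ _ _ _ (a10 e0) _ (a23 e2) _); rewrite 1?adj_sym //; apply: ne; lia.
  by apply: (adj_three _ _ _ _ a20 (a23 e2) (a24 d4)); apply: ne; lia.
split.
- apply/eqP; apply: contraT => /[dup] /a24 e4 d4.
  have := a12 e1; rewrite adj_sym => e1'.
  by exfalso; apply: (adj_three _ _ _ _ a20 e1' e4); apply: ne; lia.
- by apply: contraNN ne01 => ->.
- by apply: contraNN ne12 => ->; rewrite andbT.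
Qed.

End Path.

(* P is monomial; rho x is the position in P of the x-th standard basis vector. *)
Lemma diag_path (R : realType) n (th : 'I_n -> R) (P : 'M[R]_n) :
    injective th -> P \in unitmx ->
    is_diagonal (invmx P *m (\matrix_(i, j) if i == j then th i else 0) *m P) ->
  exists2 rho : 'I_n -> 'I_n, injective rho &
    forall (M : 'M[R]_n) x y, (M x y != 0) = ((invmx P *m M *m P) (rho x) (rho y) != 0).
Proof.
set A := \matrix_(i, j) _ => th_inj Pu; set D := _ *m P => Ddiag.
have PD : P *m D = A *m P by rewrite /D !mulmxA mulmxV // mul1mx.
have PDE x j : P x j * D j j = th x * P x j.
  have /matrixP/(_ x j) := PD; rewrite [LHS]mxE [RHS]mxE.
  rewrite (bigD1 j) //= big1 ?addr0; last first.
    by move=> k kj; rewrite Ddiag ?mulr0.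
  move=> ->; rewrite (bigD1 x) //= big1 ?addr0 ?mxE ?eqxx // => k kx.
  by rewrite mxE eq_sym (negPf kx) mul0r.
have ex x : exists j, P x j != 0.
  apply/existsP; apply: contraT; rewrite negb_exists => /forallP h.
  have /matrixP/(_ x x) := mulmxV Pu; rewrite !mxE eqxx big1 => [/esym/eqP|k _].
    by rewrite oner_eq0.
  by have := h k; rewrite negbK => /eqP->; rewrite mul0r.
pose rho x := xchoose (ex x).
have Prho x : P x (rho x) != 0 by exact: xchooseP (ex x).
(* A nonzero [P x j] fixes the eigenvalue of column j, so distinct rows have their nonzero entries
   in distinct columns. *)
have Drho x j : P x j != 0 -> D j j = th x.
  by move=> Pxj; apply: (mulfI Pxj); rewrite PDE mulrC.
have rho_inj : injective rho.
  by move=> x y xy; apply: th_inj; rewrite -(Drho _ _ (Prho x)) xy (Drho _ _ (Prho y)).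
have Peq0 x y : x != y -> P x (rho y) = 0.
  move=> xy; apply: contra_neq_eq xy => /Drho; rewrite (Drho _ _ (Prho y)).
  by move/th_inj.
exists rho => // M x y; set T := _ *m P.
have PT : P *m T = M *m P by rewrite /T !mulmxA mulmxV // mul1mx.
have /matrixP/(_ x (rho y)) := PT; rewrite [LHS]mxE [RHS]mxE.
rewrite (bigD1 (rho x)) //= big1 ?addr0; last first.
  move=> k; rewrite -(f_invF rho_inj k) => kx.
  by rewrite Peq0 ?mul0r //; apply: contraNneq kx => ->.
rewrite (bigD1 y) //= big1 ?addr0; last first.
  by move=> k ky; rewrite Peq0 ?mulr0.
move=> e.
have : (P x (rho x) * T (rho x) (rho y) != 0) = (M x y * P y (rho y) != 0).
  by rewrite e.
by rewrite !mulf_eq0 !negb_or !Prho andbT.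
Qed.

Lemma irred_tridiagonal_adj (R : realType) n (T : 'M[R]_n) (p q : 'I_n) :
  irred_tridiagonal T -> p != q -> (T p q != 0) = adj p q.
Proof.
move=> [T0 T1]; rewrite -val_eqE /adj => /= pq.
case: (p =P q.+1 :> nat) => [/T1[]//|/eqP p1].
case: (q =P p.+1 :> nat) => [/T1[]//|/eqP q1].
by rewrite T0 ?eqxx //; lia.
Qed.

(** The difference factors as (x - y)(x + y + u + 1); for distinct indices x + y is at least 1,
    while u > -2. *)
Lemma theta_inj (R : realType) d (r s : R) : -1 < r -> -1 < s ->
  injective (fun i : 'I_d.+1 => theta d r s i).
Proof.
move=> hr hs i j; rewrite /theta => /eqP; rewrite -subr_eq0.
set x := (d - i)%:R; set y := (d - j)%:R.
have -> : x * (x + r + s + 1) - y * (y + r + s + 1)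
  = (x - y) * (x + y + r + s + 1) by ring.
have xy : x = y -> i = j.
  move=> /eqP; rewrite eqr_nat => /eqP ij; apply: val_inj => /=.
  by have := ltn_ord i; have := ltn_ord j; lia.
rewrite mulf_eq0 subr_eq0 => /orP[/eqP/xy //|xy0].
have [//|nij] := eqVneq i j.
have : 1 <= x + y.
  rewrite -natrD ler1n; move: nij; rewrite -val_eqE /=.
  by have := ltn_ord i; have := ltn_ord j; lia.
by move=> xy1; exfalso; move: xy0 xy1 => /eqP; clearbody x y; clear -hr hs; lra.
Qed.

(** * Necessity of the three conditions *)

Section Converse.
Variables (R : realType) (d : nat) (r s lam : R).

Let e k := as_ d r s (d - k) + as_ d r s (d - k.+1) + 2 * lam != 0.

Lemma edges_conditions : -1 < r -> -1 < s -> (3 <= d)%N ->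
    (exists2 k, (k < d)%N & e k) ->
    (e 0%N -> ~~ e 1%N /\ ~~ e 2%N) ->
    (e 1%N -> [/\ d = 3%N, ~~ e 0%N & ~~ e 2%N]) ->
  [/\ r != 0, r + s = 0 & 2 * lam = r - d%:R].
Proof.
move=> hr hs d3.
pose A : R := (2 * d%:R - r + s) / 4.
pose w := (r - s) * (2 * d%:R + (r + s) + 2) / 4.
pose u := r + s.
have a0 : as_ d r s (d - 0) = A + w / (u + 2) by rewrite subn0 as_rev0.
have ak k : (0 < k <= d)%N ->
    as_ d r s (d - k) = A + w * (u / ((2 * k%:R + u) * (2 * k%:R + u + 2))).
  by move=> kd; rewrite as_rev.
have wE : w = (r - s) * (2 * d%:R + (r + s) + 2) / 4 by [].
clearbody w.
(* The values f1, f2, f3 of g at 1, 2, 3 are kept opaque, so that for [lra] the equations t_k = 0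
   are linear in the products of w with them. *)
have ex_f k x y : (0 < k <= 3)%N -> x = 2 * k%:R -> y = 2 * k%:R + 2 ->
    exists2 f, f = u / ((x + u) * (y + u)) & as_ d r s (d - k) = A + w * f.
  move=> /andP[k0 k3] -> ->; eexists; first by [].
  by rewrite ak ?k0 ?(leq_trans k3) // [_ + 2 + u]addrAC.
have [f1 f1E a1] := ex_f 1%N 2 4 isT ltac:(ring) ltac:(ring).
have [f2 f2E a2] := ex_f 2%N 4 6 isT ltac:(ring) ltac:(ring).
have [f3 f3E a3] := ex_f 3%N 6 8 isT ltac:(ring) ltac:(ring).
have u2 : -2 < u by rewrite /u; lra.
have e_w0 : w = 0 -> forall k, (k < d)%N -> e k = (2 * A + 2 * lam != 0).
  move=> w0 k kd; have aA j : (j <= d)%N -> as_ d r s (d - j) = A.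
    by case: (posnP j) => [-> _|j0 jd]; rewrite ?a0 ?ak ?j0 // w0 mul0r addr0.
  by rewrite /e !aA //; [congr (_ != 0); ring | lia].
move=> [k0 k0d ek0].
have [e0 /(_ isT)[e1 e2] _|e0 _] := boolP (e 0%N).
  have w0 : w != 0.
    by apply: contraNneq e1 => /e_w0 h; rewrite h -1?(h 0%N) //; lia.
  move: e1 e2; rewrite /e !negbK a1 a2 a3 => /eqP e1 /eqP e2.
  have u0 : u = 0.
    (* This is t_1 - t_2; the second factor is u times a positive number. *)
    have : w * (f1 - f3) = 0 by rewrite mulrBr; lra.
    have -> : f1 - f3 = u * ((8 * u + 40) / ((2 + u) * (4 + u) * (6 + u) * (8 + u))).
      by rewrite f1E f3E; field; rewrite !gt_eqF //; lra.
    have pos : 0 < (8 * u + 40) / ((2 + u) * (4 + u) * (6 + u) * (8 + u)).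
      by rewrite divr_gt0 ?mulr_gt0 //; lra.
    by move/eqP; rewrite mulf_eq0 (negPf w0) /= mulf_eq0 (gt_eqF pos) orbF => /eqP.
  split=> //.
    apply: contraNneq w0 => r0; rewrite wE.
    by move: u0; rewrite /u r0 add0r => ->; rewrite subrr !mul0r.
  by move: e1; rewrite f1E f2E u0 !mul0r !mulr0 !addr0 /A; move: u0; rewrite /u; lra.
(* If w = 0, all [e k] agree, and the failure of [e 0] contradicts [ek0]. *)
move=> he1; suff w0 : w = 0.
  by move: ek0 e0; rewrite !e_w0 //; [move=> -> | lia].
move: e0; rewrite /e negbK a0 a1 => /eqP t0.
have [/he1[d_eq _ e2]|e1] := boolP (e 1%N).
  move: e2; rewrite /e negbK a2 a3 => /eqP t2.
  (* This is t_0 - t_2. *)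
  have : w * ((u + 2)^-1 + f1 - f2 - f3) = 0 by rewrite !mulrBr mulrDr; lra.
  have -> : (u + 2)^-1 + f1 - f2 - f3 = 16 / ((4 + u) * (8 + u)).
    by rewrite f1E f2E f3E; field; rewrite !gt_eqF //; lra.
  have pos : 0 < 16 / ((4 + u) * (8 + u)) by rewrite divr_gt0 ?mulr_gt0 //; lra.
  by move/eqP; rewrite mulf_eq0 (gt_eqF pos) orbF => /eqP.
move: e1; rewrite /e negbK a1 a2 => /eqP t1.
(* This is t_0 - t_1. *)
have : w * ((u + 2)^-1 - f2) = 0 by rewrite mulrBr; lra.
have -> : (u + 2)^-1 - f2 = (8 * u + 24) / ((2 + u) * (4 + u) * (6 + u)).
  by rewrite f2E; field; rewrite !gt_eqF //; lra.
have pos : 0 < (8 * u + 24) / ((2 + u) * (4 + u) * (6 + u)).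
  by rewrite divr_gt0 ?mulr_gt0 //; lra.
by move/eqP; rewrite mulf_eq0 (gt_eqF pos) orbF => /eqP.
Qed.

Lemma leonard_necessary : -1 < r -> -1 < s -> (3 <= d)%N ->
    leonard_pair (Lmx d r s) ((Lsmx d r s + lam%:M) *m (Lsmx d r s + lam%:M)) ->
  [/\ r != 0, r + s = 0 & 2 * lam = r - d%:R].
Proof.
move=> hr hs d3; set M := _ *m _ => -[_ [[P [Pu [diagL tridM]]] _]].
have [rho rho_inj rhoM] := diag_path R d.+1 _ P (theta_inj R d r s hr hs) Pu diagL.
pose v k : 'I_d.+1 := inord (d - k).
have vE k : (k <= d)%N -> v k = (d - k)%N :> nat by move=> kd; rewrite inordK //; lia.
have M_adj x y : x != y -> (M x y != 0) = adj (rho x) (rho y).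
  move=> xy; rewrite rhoM (irred_tridiagonal_adj _ _ _ _ _ tridM) //.
  by rewrite (inj_eq rho_inj).
have v_inj x y : (x <= d)%N -> (y <= d)%N -> v x = v y -> x = y.
  by move=> xd yd /(congr1 (@nat_of_ord _)); rewrite !vE //; lia.
have Mv k l : (l < k <= d)%N -> (M (v k) (v l) != 0) = (k == l.+2) || (k == l.+1) && e l.
  move=> /andP[lk kd]; have [] := Lsmx_sq_neq0 R d r s lam (v k) (v l) hr hs.
    by rewrite !vE //; lia.
  move=> -> _; rewrite !vE //; try lia.
  have -> : (d - l == (d - k).+2)%N = (k == l.+2) by apply/eqP/eqP; lia.
  have -> : (d - l == (d - k).+1)%N = (k == l.+1) by apply/eqP/eqP; lia.
  congr (_ || _); case: eqP => //= kl.
  by rewrite /e -kl; have -> : (d - k).+1 = (d - l)%N by [lia]; rewrite [as_ _ _ _ _ + _]addrC.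
have adjv k l : (l < k <= d)%N -> adj (rho (v l)) (rho (v k)) = (k == l.+2) || (k == l.+1) && e l.
  move=> /[dup] lk /andP[lk1 kd]; rewrite -Mv // M_adj 1?adj_sym //.
  by apply/eqP => /v_inj; lia.
have [e0 e1] : (e 0%N -> ~~ e 1%N /\ ~~ e 2%N) /\
    (e 1%N -> [/\ d = 3%N, ~~ e 0%N & ~~ e 2%N]).
  apply: (path_chords d (fun k => rho (v k))) => //.
  - by move=> x y xd yd /val_inj/rho_inj/v_inj; exact.
  - by move=> k kd; rewrite adjv ?eqxx //; lia.
  - by move=> k kd ek; rewrite adjv ?eqxx ?ek ?orbT //; lia.
apply: edges_conditions => //.
have [/existsP[k ek]|noe] := boolP [exists k : 'I_d, e k]; first by exists k.
(* Without such an edge only indices of equal parity are joined, so parity would be constant along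
   the whole path. *)
have {}noe k : (k < d)%N -> ~~ e k.
  by move=> kd; apply: contraNN noe => ek; apply/existsP; exists (Ordinal kd).
suff: odd (v 0%N) = odd (v 1%N) by rewrite !vE //; lia.
apply: (path_const _ _ rho (fun x => odd x)) => // x y xy.
have vd (z : 'I_d.+1) : v (d - z)%N = z.
  by apply: val_inj => /=; have zd := ltn_ord z; rewrite vE; lia.
have axy : adj (rho x) (rho y) by rewrite /adj xy eqxx orbT.
have [xd yd] := (ltn_ord x, ltn_ord y).
case: (ltngtP x y) => [lt_xy|lt_yx|-> //].
- have := adjv (d - x)%N (d - y)%N; rewrite !vd adj_sym axy.
  by rewrite (negPf (noe (d - y)%N _)) ?andbF; lia.
- have := adjv (d - y)%N (d - x)%N; rewrite !vd axy.
  by rewrite (negPf (noe (d - x)%N _)) ?andbF; lia.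
Qed.


End Converse.

(** * Reordering the standard basis along a zigzag *)

(* Position of k in the path ... 5, 3, 1, 0, 2, 4 ... on {0, ..., d}. *)
Definition zigzag (d k : nat) : nat :=
  if odd k then (uphalf d - uphalf k)%N else (uphalf d + k./2)%N.

Lemma zigzag_le d k : (k <= d)%N -> (zigzag d k <= d)%N.
Proof. by rewrite /zigzag; case: ifP; lia. Qed.

Lemma zigzag_inj d k l : (k <= d)%N -> (l <= d)%N -> zigzag d k = zigzag d l -> k = l.
Proof. by rewrite /zigzag; do 2!case: ifP; lia. Qed.

Lemma zigzag_adj d k l : (l < k <= d)%N ->
  adj (zigzag d k) (zigzag d l) = (k == l.+2) || (k == l.+1) && (l == 0%N).
Proof. by rewrite /zigzag /adj; do 2!case: ifP; lia. Qed.

Lemma perm_conj (R : realType) n (sg : 'S_n) (M : 'M[R]_n) x y :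
  (invmx (perm_mx sg) *m M *m perm_mx sg) (sg x) (sg y) = M x y.
Proof.
have -> : invmx (perm_mx sg) = perm_mx sg^-1%g :> 'M[R]_n.
  have u := unitmx_perm R sg.
  by rewrite -[RHS](mulKmx u) -perm_mxM mulgV perm_mx1 mulmx1.
by rewrite -row_permE -[in perm_mx sg](invgK sg) -col_permE !mxE !permK.
Qed.

(** The only edge between neighbouring indices ends at d; in the reversed indexing it joins 0 and 1,
    the turning point of the zigzag. Permuting the basis accordingly keeps [A] diagonal. *)
Lemma zigzag_leonard (R : realType) d (A M : 'M[R]_d.+1) :
    is_diagonal A ->
    (forall i j : 'I_d.+1, (i < j)%N ->
       let e := (j == i.+2 :> nat) || (j == i.+1 :> nat) && (j == d :> nat) in
       (M i j != 0) = e /\ (M j i != 0) = e) ->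
  exists P : 'M[R]_d.+1, P \in unitmx /\
    is_diagonal (invmx P *m A *m P) /\ irred_tridiagonal (invmx P *m M *m P).
Proof.
move=> diagA Me.
pose f (i : 'I_d.+1) : 'I_d.+1 := inord (zigzag d (d - i)%N).
have fE i : f i = zigzag d (d - i)%N :> nat.
  by rewrite inordK // ltnS zigzag_le // leq_subr.
have f_inj : injective f.
  move=> i j /(congr1 (@nat_of_ord _)); rewrite !fE => /zigzag_inj.
  move=> /(_ (leq_subr _ _) (leq_subr _ _)) ij; apply: val_inj => /=.
  by have := ltn_ord i; have := ltn_ord j; lia.
pose sg := perm f_inj.
have M_adj i j : i != j -> (M i j != 0) = adj (sg i) (sg j).
  rewrite -val_eqE /= neq_ltn !permE !fE => /orP[ij|ji].
    have [-> _] := Me _ _ ij; have := ltn_ord j => jd.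
    by rewrite zigzag_adj; [apply/idP/idP; lia | lia].
  have [_ ->] := Me _ _ ji; have := ltn_ord i => id.
  by rewrite adj_sym zigzag_adj; [apply/idP/idP; lia | lia].
exists (perm_mx sg); split; first exact: unitmx_perm.
split=> [p q|]; last split=> p q.
- rewrite -(permKV sg p) -(permKV sg q) perm_conj => pq; apply: diagA.
  by apply: contraNneq pq => ->.
- rewrite -(permKV sg p) -(permKV sg q) perm_conj.
  move: (sg^-1%g p) (sg^-1%g q) => x y far.
  have xy : x != y by apply: contraTneq isT => xy; move: far; rewrite xy; lia.
  by apply/eqP; apply: contraTT isT; rewrite M_adj // /adj; lia.
- rewrite -(permKV sg p) -(permKV sg q) !perm_conj.
  move: (sg^-1%g p) (sg^-1%g q) => x y near.
  have xy : x != y by apply: contraTneq isT => xy; move: near; rewrite xy; lia.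
  have yx : y != x by rewrite eq_sym.
  by rewrite (M_adj x y xy) (M_adj y x yx) /adj near eqxx orbT.
Qed.

(** * Dual Hahn polynomials for u = 0 *)

Section Eigenbasis.
Variable R : realType.
Implicit Types (x z : R) (j n : nat).

(* phi j k is the product of theta(k) - theta(m) over m < j, where
   theta(k) = k (k + 1). *)
Definition phi j x : R := \prod_(m < j) ((x - m%:R) * (x + m%:R + 1)).

Lemma phi0 x : phi 0 x = 1. Proof. by rewrite /phi big_ord0. Qed.

Lemma phiS j x : phi j.+1 x = phi j x * ((x - j%:R) * (x + j%:R + 1)).
Proof. by rewrite /phi big_ord_recr. Qed.

(** [phi j x] is the product of the 2j consecutive numbers x - j + 1, ..., x + j. Shifting x by one
    while raising j adds two factors at one end; [phi_down] adds them at the other. *)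
Lemma phi_up j x : phi j.+1 (x + 1) = phi j x * ((x + j%:R + 2) * (x + j%:R + 1)).
Proof.
elim: j => [|j IHj]; first by rewrite phiS !phi0; ring.
by rewrite phiS IHj phiS -!natr1; ring.
Qed.

Lemma phi_down j x : phi j.+1 (x - 1) = phi j x * ((x - j%:R) * (x - j%:R - 1)).
Proof.
elim: j => [|j IHj]; first by rewrite phiS !phi0; ring.
by rewrite phiS IHj phiS -!natr1; ring.
Qed.

Lemma phi_eq0 j k : (k < j)%N -> phi j k%:R = 0.
Proof. by move=> kj; rewrite /phi (bigD1 (Ordinal kj)) //= subrr !mul0r. Qed.

Lemma phi_diag_neq0 j : phi j j%:R != 0.
Proof.
rewrite /phi; apply/prodf_neq0 => m _; rewrite mulf_neq0 //.
  by rewrite subr_eq0 eqr_nat gtn_eqF.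
by rewrite -natrD natr1 pnatr_eq0.
Qed.

Variables (d : nat) (r s : R).

(** L* is bidiagonal in the basis of the phi_j; this is the coefficient of phi_j in the image of
    phi_(j+1). *)
Definition split_b j : R := - (j.+1%:R * (j.+1%:R + r) * (d%:R - j%:R)).

(** For j > 0 all terms are multiples of phi_(j-1), which leaves an identity between rational
    functions of k. The node k = 0 is checked apart, c*_d having its own form. *)
Lemma Ls_phi (hr : -1 < r) (hs : -1 < s) (rs : r + s = 0) j i : (i <= d)%N ->
  bs d r s i * phi j (d%:R - i.+1%:R) + as_ d r s i * phi j (d%:R - i%:R)
    + cs d r s i * phi j (d%:R - i.-1%:R)
  = j%:R * phi j (d%:R - i%:R)
    + (if (0 < j)%N then split_b j.-1 * phi j.-1 (d%:R - i%:R) else 0).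
Proof.
move=> id; have s_eq : s = - r by lra.
have [k kd ->] : exists2 k, (k <= d)%N & i = (d - k)%N by exists (d - i)%N; lia.
set up := phi j (_ - _.-1%:R).
(* At i = 0 the truncated predecessor gives the wrong node, but c*_0 = 0. *)
have -> : cs d r s (d - k) * up = cs d r s (d - k) * phi j (k%:R + 1).
  have [kd0|kd0] := posnP (d - k)%N; first by rewrite kd0 !mul0r.
  congr (_ * phi j _).
  have -> : (d - k).-1%:R = d%:R - k%:R - 1 :> R by rewrite -subn1 natrB // natrB.
  by ring.
have -> : d%:R - (d - k).+1%:R = k%:R - 1 :> R by rewrite -natr1 natrB //; ring.
have -> : d%:R - (d - k)%:R = k%:R :> R by rewrite natrB //; ring.
rewrite /as_ /thetas.
case: j {up} => [|j]; first by rewrite !phi0 /=; ring.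
rewrite phi_up phi_down phiS /split_b /= -natr1.
case: k kd => [|k] kd.
  rewrite subn0 bs_rev0 cs_rev0 // s_eq.
  case: j => [|j]; last by rewrite (phi_eq0 j.+1 0) //; ring.
  by rewrite phi0; field; rewrite !gt_eqF //; lra.
have k1 : 0 < k.+1%:R :> R by rewrite ltr0n.
rewrite bs_rev ?cs_rev ?kd // s_eq.
field.
by move: k1; rewrite -natr1 => k1; rewrite !gt_eqF //; lra.
Qed.

(* The coefficient of phi j in the dual Hahn polynomial R_n, n = z, that is, in
   3F2(-n, -x, x + 1; r + 1, -d; 1). *)
Definition alpha z j : R :=
  poch (- z) j * \prod_(m < j) (m.+1%:R * (m.+1%:R + r) * (d%:R - m%:R))^-1.

Lemma alpha0 z : alpha z 0 = 1.
Proof. by rewrite /alpha poch0 big_ord0 mul1r. Qed.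

Lemma split_b_neq0 (hr : -1 < r) j : (j < d)%N -> split_b j != 0.
Proof.
move=> jd; have j1 : 1 <= j.+1%:R :> R by rewrite ler1n.
have jd' : j%:R < d%:R :> R by rewrite ltr_nat.
rewrite /split_b oppr_eq0 !mulf_eq0 !negb_or.
by do ?[apply/andP; split]; rewrite gt_eqF //; lra.
Qed.

Lemma alphaS (hr : -1 < r) z j : (j < d)%N -> alpha z j.+1 * split_b j = (z - j%:R) * alpha z j.
Proof.
move=> jd; have := split_b_neq0 hr j jd; rewrite /split_b oppr_eq0 => b0.
rewrite /alpha pochSr big_ord_recr /=.
set p := \prod_(_ < _) _; set q := _ * _ in b0 *.
by rewrite mulrN -[_ * q]mulrA -[p / q * q]mulrA mulVf //; ring.
Qed.

Lemma alpha_eq0 n j : (n < j)%N -> alpha n%:R j = 0.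
Proof.
move=> nj; rewrite /alpha /poch (bigD1 (Ordinal nj)) //=.
by rewrite addNr !mul0r.
Qed.

Lemma alpha_diag_neq0 (hr : -1 < r) n : (n <= d)%N -> alpha n%:R n != 0.
Proof.
move=> nd; rewrite /alpha /poch mulf_neq0 //; apply/prodf_neq0 => m _.
  by rewrite addrC subr_eq0 eqr_nat ltn_eqF.
have := split_b_neq0 hr m; rewrite /split_b oppr_eq0 invr_eq0; apply.
exact: leq_trans (ltn_ord m) nd.
Qed.

(** In coordinates on the phi_j, this is the eigenvector equation of L* for the eigenvalue n. At j =
    d it holds because [alpha n%:R d] vanishes unless n = d. *)
Lemma alpha_eigen (hr : -1 < r) n j : (j <= d)%N -> (n <= d)%N ->
  (if (j < d)%N then split_b j * alpha n%:R j.+1 else 0) + j%:R * alpha n%:R j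
    = alpha n%:R j * n%:R.
Proof.
move=> jd nd; case: ltnP => [jd'|dj]; first by rewrite mulrC alphaS //; ring.
have -> : j = d by apply/eqP; rewrite eqn_leq jd.
have [->|nd'] := eqVneq n d; first by rewrite add0r mulrC.
by rewrite alpha_eq0 ?mul0r ?mulr0 ?addr0 // ltn_neqAle nd'.
Qed.

(* Coefficients of the three-term recurrence
   x (x + 1) R_n = C_n R_(n-1) - (A_n + C_n) R_n + A_n R_(n+1). *)
Definition rec_A z : R := (z + r + 1) * (z - d%:R).
Definition rec_C z : R := z * (z + r - d%:R - 1).

(** Since x (x + 1) phi_j = phi_(j+1) + j (j + 1) phi_j, the left side is the coefficient of phi_j
    in x (x + 1) R_z. *)
Lemma alpha_rec (hr : -1 < r) z j : (j <= d)%N ->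
  j%:R * (j%:R + 1) * alpha z j + (if (0 < j)%N then alpha z j.-1 else 0)
  = alpha (z - 1) j * rec_C z - alpha z j * (rec_A z + rec_C z)
    + alpha (z + 1) j * rec_A z.
Proof.
case: j => [|j] jd; first by rewrite !alpha0 /rec_A /rec_C /=; ring.
have b0 := split_b_neq0 hr j jd.
rewrite /alpha /= big_ord_recr /=; move: b0; rewrite /split_b oppr_eq0.
set h := \prod_(_ < _) _; set q := _ * _ => q0.
have hE : h = h / q * q by rewrite divfK.
rewrite [X in _ + _ * X]hE; set g := h / q.
(* The factor z of [rec_C z] completes the shifted symbol to [poch (- z) j.+2], up to sign. *)
have pC : poch (- (z - 1)) j.+1 * rec_C z
    = - (z + r - d%:R - 1) * (poch (- z) j * (- z + j%:R) * (- z + j.+1%:R)).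
  rewrite -!pochSr (pochS _ (- z)) /rec_C; have -> : - (z - 1) = - z + 1 by ring.
  by ring.
have pA : poch (- (z + 1)) j.+1 = - (z + 1) * poch (- z) j.
  by rewrite pochS; congr (_ * poch _ _); ring.
rewrite [X in X + _]mulrAC.
have -> : poch (- (z - 1)) j.+1 * g * rec_C z = poch (- (z - 1)) j.+1 * rec_C z * g.
  by ring.
by rewrite pC pA pochSr /q /rec_A /rec_C -!natr1; ring.
Qed.


End Eigenbasis.

(** * Matrix form and the second basis *)

Section EigenMatrix.
Variables (R : realType) (d : nat) (r s : R).

Definition trimx (b a c : nat -> R) : 'M[R]_d.+1 := \matrix_(i, j) tri R b a c i j.

Definition phi_mx : 'M[R]_d.+1 := \matrix_(i, j) phi R j (d%:R - i%:R).

Definition alpha_mx : 'M[R]_d.+1 := \matrix_(j, n) alpha R d r n%:R j.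

(** Column n holds the recurrence coefficients of R_n, hence the shifted indices off the
    diagonal. *)
Definition rec_mx : 'M[R]_d.+1 :=
  trimx (fun n => rec_C R d r n.+1%:R) (fun n => - (rec_A R d r n%:R + rec_C R d r n%:R))
    (fun n => rec_A R d r n.-1%:R).

Lemma trimx_mulE b a c (F : nat -> nat -> R) (i j : 'I_d.+1) : b d = 0 -> c 0%N = 0 ->
  (trimx b a c *m \matrix_(m, n) F m n) i j
    = b i * F i.+1 j + a i * F i j + c i * F i.-1 j.
Proof.
move=> b0 c0; rewrite mxE; under eq_bigr do rewrite !mxE.
by rewrite (sum_trir R d b a c (F ^~ j)) ?leq_ord.
Qed.

Lemma mul_trimxE b a c (F : nat -> nat -> R) (i j : 'I_d.+1) : c d.+1 = 0 \/ F i d.+1 = 0 ->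
  ((\matrix_(m, n) F m n) *m trimx b a c) i j
    = (if (0 < j)%N then F i j.-1 * b j.-1 else 0) + F i j * a j + F i j.+1 * c j.+1.
Proof.
move=> cF; rewrite mxE; under eq_bigr do rewrite !mxE.
by rewrite (sum_tril R d b a c (F i)) ?leq_ord.
Qed.

Lemma phi_last (i : 'I_d.+1) : phi R d.+1 (d%:R - i%:R) = 0.
Proof. by rewrite -natrB ?leq_ord // phi_eq0 // ltnS leq_subr. Qed.

Lemma Ls_phi_mx : -1 < r -> -1 < s -> r + s = 0 ->
  Lsmx d r s *m phi_mx
    = phi_mx *m trimx (split_b R d r) (fun j => j%:R) (fun=> 0).
Proof.
move=> hr hs rs; apply/matrixP => i j.
rewrite (mul_trimxE _ _ _ (fun m n => phi R n (d%:R - m%:R))); last by left.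
rewrite (trimx_mulE _ _ _ (fun m n => phi R n (d%:R - m%:R))) ?bs_rev0 //.
rewrite Ls_phi // ?leq_ord // mulr0 addr0 addrC [X in _ + X]mulrC.
by congr (_ + _); case: ifP => // _; rewrite mulrC.
Qed.

(** With u = 0 the eigenvalue at node k is k (k + 1), and phi_(d+1) vanishes at every node, so the
    last column closes up. *)
Lemma L_phi_mx : r + s = 0 ->
  Lmx d r s *m phi_mx
    = phi_mx *m trimx (fun=> 0) (fun j => j%:R * (j%:R + 1)) (fun j => (0 < j)%N%:R).
Proof.
move=> rs; apply/matrixP => i j.
rewrite (mul_trimxE _ _ _ (fun m n => phi R n (d%:R - m%:R))); last first.
  by right; exact: phi_last.
have -> : Lmx d r s = diag_mx (\row_i theta d r s i).
  by apply/matrixP => k l; rewrite !mxE; case: eqVneq; rewrite ?mulr1n ?mulr0n.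
rewrite mul_diag_mx !mxE /theta natrB ?leq_ord // -(addrA _ r s) rs phiS /=.
by rewrite mulr0 if_same; ring.
Qed.

Lemma Ls_alpha_mx : -1 < r ->
  trimx (split_b R d r) (fun j => j%:R) (fun=> 0) *m alpha_mx
    = alpha_mx *m diag_mx (\row_n n%:R).
Proof.
move=> hr; apply/matrixP => j n.
rewrite mul_mx_diag !mxE -(alpha_eigen _ d r) ?leq_ord //.
have := trimx_mulE (split_b R d r) (fun j => j%:R) (fun=> 0)
  (fun m n => alpha R d r n%:R m) j n.
rewrite /alpha_mx !mxE => ->; rewrite ?mul0r ?addr0 //; last first.
  by rewrite /split_b subrr mulr0 oppr0.
congr (_ + _); case: ltnP => // dj.
have -> : j = d :> nat by apply/eqP; rewrite eqn_leq dj -ltnS ltn_ord.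
by rewrite /split_b subrr mulr0 oppr0 mul0r.
Qed.

Lemma L_alpha_mx : -1 < r ->
  trimx (fun=> 0) (fun j => j%:R * (j%:R + 1)) (fun j => (0 < j)%N%:R) *m alpha_mx
    = alpha_mx *m rec_mx.
Proof.
move=> hr; apply/matrixP => j n.
rewrite (mul_trimxE _ _ _ (fun m n => alpha R d r n%:R m)); last first.
  (* A_d = 0: the recurrence stops at R_d. *)
  by left; rewrite /rec_A subrr mulr0.
rewrite (trimx_mulE _ _ _ (fun m n => alpha R d r n%:R m)) //.
have jd : (j <= d)%N by rewrite -ltnS.
transitivity (j%:R * (j%:R + 1) * alpha R d r n%:R j
    + (if (0 < j)%N then alpha R d r n%:R j.-1 else 0)).
  by case: (0 < j)%N; rewrite /=; ring.
rewrite (alpha_rec R d r hr n%:R j jd) natr1 mulrN /=; congr (_ - _ + _).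
case: n => -[|n] nd /=; first by rewrite /rec_C mul0r mulr0.
by rewrite -natr1 addrK.
Qed.

(** Reversing the rows makes the matrix lower triangular with nonzero diagonal. *)
Lemma phi_mx_unit : phi_mx \in unitmx.
Proof.
pose T : 'M[R]_d.+1 := \matrix_(i, j) phi R j i%:R.
have -> : phi_mx = row_perm (perm rev_ord_inj) T.
  apply/matrixP => i j; rewrite !mxE permE /= subSS natrB //.
  by rewrite -ltnS.
rewrite row_permE unitmx_mul unitmx_perm unitmxE det_trig.
  by rewrite unitfE; apply/prodf_neq0 => i _; rewrite mxE phi_diag_neq0.
by apply/is_trig_mxP => i j ij; rewrite mxE phi_eq0.
Qed.

Lemma alpha_mx_unit : -1 < r -> alpha_mx \in unitmx.
Proof.
move=> hr; rewrite -unitmx_tr unitmxE det_trig.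
  by rewrite unitfE; apply/prodf_neq0 => i _; rewrite !mxE alpha_diag_neq0 ?leq_ord.
by apply/is_trig_mxP => i j ij; rewrite !mxE alpha_eq0.
Qed.

(** The bounds on r make A_n negative for n < d and C_n negative for 0 < n <= d; the upper bound
    will come from s = -r > -1. *)
Lemma rec_mx_irred : -1 < r -> r < 1 -> irred_tridiagonal rec_mx.
Proof.
move=> hr r1; split=> i j.
  by move=> ij; rewrite mxE tri_far //; lia.
move=> ji; rewrite !mxE ji tri_up tri_down /=.
have id : i.+1%:R <= d%:R :> R by rewrite ler_nat -ltnS -ji ltn_ord.
have i0 : 0 <= i%:R :> R by [].
move: id; rewrite -natr1 /rec_A /rec_C => id.
by split; rewrite mulf_neq0 //; (rewrite gt_eqF //; lra) || (rewrite lt_eqF //; lra).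
Qed.

Lemma leonard_eigenbasis (lam : R) : -1 < r -> -1 < s -> r + s = 0 ->
  exists Q : 'M[R]_d.+1, Q \in unitmx /\
    is_diagonal (invmx Q *m ((Lsmx d r s + lam%:M) *m (Lsmx d r s + lam%:M)) *m Q) /\
    irred_tridiagonal (invmx Q *m Lmx d r s *m Q).
Proof.
(* Column n of [Q] lists the values of R_n at the nodes k = d - i. *)
move=> hr hs rs; pose Q := phi_mx *m alpha_mx.
have Qu : Q \in unitmx by rewrite unitmx_mul phi_mx_unit alpha_mx_unit.
have LsQ : (Lsmx d r s + lam%:M) *m Q = Q *m diag_mx (\row_n (n%:R + lam)).
  rewrite mulmxDl mulmxA Ls_phi_mx // -[_ *m _ *m alpha_mx]mulmxA Ls_alpha_mx //.
  rewrite mulmxA mul_scalar_mx -mul_mx_scalar -mulmxDr; congr (_ *m _).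
  by apply/matrixP => i j; rewrite !mxE -mulrnDl; case: eqP => // ->.
have LQ : Lmx d r s *m Q = Q *m rec_mx.
  by rewrite mulmxA L_phi_mx // -mulmxA L_alpha_mx // mulmxA.
exists Q; split=> //; split.
  rewrite -mulmxA -[_ *m _ *m Q]mulmxA LsQ mulmxA LsQ -mulmxA mulmx_diag mulKmx //.
  by move=> i j ij; rewrite mxE (negPf ij) mulr0n.
by rewrite -mulmxA LQ mulKmx //; apply: rec_mx_irred => //; lra.
Qed.

Lemma leonard_sufficient (lam : R) : -1 < r -> -1 < s ->
    r != 0 -> r + s = 0 -> 2 * lam = r - d%:R ->
  leonard_pair (Lmx d r s) ((Lsmx d r s + lam%:M) *m (Lsmx d r s + lam%:M)).
Proof.
move=> hr hs r0 rs lamE; split=> //; split; last exact: leonard_eigenbasis.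
apply: zigzag_leonard => [i j ij|i j ij]; first by rewrite mxE (negPf ij).
have [] := Lsmx_sq_neq0 R d r s lam i j hr hs ij.
have -> // : (j == i.+2 :> nat)
    || (j == i.+1 :> nat) && (as_ d r s i + as_ d r s i.+1 + 2 * lam != 0)
  = (j == i.+2 :> nat) || (j == i.+1 :> nat) && (j == d :> nat).
congr (_ || _); case: eqP => //= ji.
have jd : (j <= d)%N by rewrite -ltnS.
have s_eq : s = - r by lra.
(* As u = 0, g vanishes for k > 0, so all a*_i with i < d coincide. *)
have -> : as_ d r s i = (d%:R - r) / 2.
  have -> : nat_of_ord i = (d - (d - i))%N by lia.
  by rewrite as_rev //; [rewrite rs s_eq mul0r mulr0; field | lia].
(* The value of lam cancels every pair except the one with j = d, which leaves r (d + 1) / 2. *)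
rewrite -ji lamE; have [->|jd'] := eqVneq (j : nat) d.
  rewrite as_rev0 // rs s_eq.
  have -> : (d%:R - r) / 2 + ((2 * d%:R - r - r) / 4
      + (r - - r) * (2 * d%:R + 0 + 2) / 4 / (0 + 2)) + (r - d%:R) = r * d.+1%:R / 2.
    by rewrite -natr1; field.
  by rewrite !mulf_neq0 ?invr_eq0 // pnatr_eq0.
have -> : nat_of_ord j = (d - (d - j))%N by lia.
rewrite as_rev //; last by lia.
by rewrite rs s_eq mul0r mulr0; apply/eqP/eqP; rewrite -(rwP eqP); field.
Qed.

End EigenMatrix.

Theorem theorem2p12 (R : realType) (d : nat) (r s : R)
    (hr : -1 < r) (hs : -1 < s) (lam : R) :
  (r != 0 -> r + s = 0 -> 2 * lam = r - d%:R ->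
     leonard_pair (Lmx d r s)
       ((Lsmx d r s + lam%:M) *m (Lsmx d r s + lam%:M))) /\
  ((3 <= d)%N ->
     leonard_pair (Lmx d r s)
       ((Lsmx d r s + lam%:M) *m (Lsmx d r s + lam%:M)) ->
     [/\ r != 0, r + s = 0 & 2 * lam = r - d%:R]).
Proof.
by split=> *; [exact: leonard_sufficient | exact: leonard_necessary].
Qed.
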